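(* Let $F$ be a field and $A$ a unital $F$-algebra of countable dimension. Then $A$ is linear sofic if and only if $SR(A)=0$.
   Context: For $a\in M_n(F)$, $\rho(a)=\operatorname{rk}(a)/n$; for a non-principal ultrafilter $\omega$ on $\mathbb{N}$ and $n_k\to\infty$, $\prod_{k\to\omega}M_{n_k}(F)/\operatorname{Ker}\rho_\omega$ is the quotient of $\prod_kM_{n_k}(F)$ by the ideal of sequences with $\lim_{k\to\omega}\rho(a_k)=0$. $A$ is linear sofic if there is an injective unital algebra morphism $A\to\prod_{k\to\omega}M_{n_k}(F)/\operatorname{Ker}\rho_\omega$ for some such $\omega,(n_k)$. For a finite-dimensional subspace $L\subseteq A$ with $1\in L$ and $\varepsilon>0$, an $\varepsilon$-almost representation of $L$ is a linear map $\psi:L\to\operatorname{End}_F(V)$, $V$ a finite-dimensional $F$-vector space, with $\psi(1)=\mathrm{Id}$, such that there is a subspace $V_\varepsilon\subseteq V$ with $\dim V-\dim V_\varepsilon<\varepsilon\dim V$ and $\psi(a)\psi(b)v=\psi(ab)v$ for all $a,b\in L$ with $ab\in L$ and all $v\in V_\varepsilon$. $A$ has almost finite dimensional representations if every such $L$ has an $\varepsilon$-almost representation for every $\varepsilon>0$. The sofic radical $SR(A)$: if $A$ does not have almost finite dimensional representations, $SR(A)=A$; otherwise $p\in SR(A)$ iff for every $\delta>0$ there exist a finite-dimensional subspace $L$ with $\{1,p\}\subseteq L\subseteq A$ and $\eta>0$ such that for every $0<\varepsilon<\eta$ and every $\varepsilon$-almost representation $\psi:L\to\operatorname{End}_F(V)$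 one has $\dim\operatorname{Ran}\psi(p)<\delta\dim V$. *)

(* Defs.v *)
From HB Require Import structures.
From mathcomp Require Import all_boot all_order all_algebra.
Set Implicit Arguments. Unset Strict Implicit. Unset Printing Implicit Defensive.
Import Order.TTheory GRing.Theory Num.Theory.
Local Open Scope ring_scope.

Definition inspan (F : fieldType) (A : lmodType F) (s : seq A) (x : A) : Prop :=
  exists c : 'I_(size s) -> F, x = \sum_(i < size s) c i *: s`_i.

Definition countable_dim (F : fieldType) (A : lmodType F) : Prop :=
  exists e : nat -> A, forall x : A, exists n : nat, inspan [seq e i | i <- iota 0 n] x.

Definition ultrafilter (U : (nat -> Prop) -> Prop) : Prop :=
  [/\ U (fun _ => True), ~ U (fun _ => False),
      (forall S T : nat -> Prop, U S -> (forall k, S k -> T k) -> U T),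
      (forall S T : nat -> Prop, U S -> U T -> U (fun k => S k /\ T k)) &
      (forall S : nat -> Prop, U S \/ U (fun k => ~ S k))].

Definition nonprincipal (U : (nat -> Prop) -> Prop) : Prop :=
  forall m : nat, ~ U (fun k => k = m).

Definition tends_to_infty (n : nat -> nat) : Prop :=
  forall N : nat, exists K : nat, forall k : nat, (K <= k)%N -> (N <= n k)%N.

Definition rho_null (F : fieldType) (U : (nat -> Prop) -> Prop) (n : nat -> nat)
  (a : forall k, 'M[F]_(n k)) : Prop :=
  forall eps : rat, 0 < eps ->
    U (fun k => ((\rank (a k))%:R / (n k)%:R : rat) < eps).

(* A is linear sofic: there is an injective unital algebra morphism
   A -> prod_{k->omega} M_{n_k}(F) / Ker rho_omega.  The morphism is given
   by a lift phi : A -> prod_k M_{n_k}(F) (a choice of representatives);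
   the morphism conditions hold modulo Ker rho_omega, and injectivity means
   that only 0 is mapped into Ker rho_omega. *)
Definition linear_sofic (F : fieldType) (A : algType F) : Prop :=
  exists (U : (nat -> Prop) -> Prop) (n : nat -> nat)
         (phi : A -> forall k, 'M[F]_(n k)),
  [/\ ultrafilter U, nonprincipal U & tends_to_infty n] /\
  [/\ (forall x y : A, rho_null U (fun k => phi (x + y) k - phi x k - phi y k)),
      (forall (c : F) (x : A), rho_null U (fun k => phi (c *: x) k - c *: phi x k)),
      (forall x y : A, rho_null U (fun k => phi (x * y) k - phi x k *m phi y k)),
      rho_null U (fun k => phi 1 k - 1%:M) &
      (forall x : A, rho_null U (phi x) -> x = 0)].

(* psi : L -> End_F(F^d) (L = span s) is an eps-almost representation.
   Endomorphisms of V = 'rV_d are matrices acting by v |-> v *m M, so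
   psi(a) psi(b) v is  v *m psi b *m psi a.  V_eps is the row space of W. *)
Definition almost_rep (F : fieldType) (A : algType F) (s : seq A) (eps : rat)
  (d : nat) (psi : A -> 'M[F]_d) : Prop :=
  [/\ (forall (c : F) (x y : A), inspan s x -> inspan s y ->
         psi (c *: x + y) = c *: psi x + psi y),
      psi 1 = 1%:M &
      exists W : 'M[F]_d,
        ((d - \rank W)%:R : rat) < eps * d%:R /\
        (forall a b : A, inspan s a -> inspan s b -> inspan s (a * b) ->
           forall v : 'rV[F]_d, (v <= W)%MS ->
             v *m psi b *m psi a = v *m psi (a * b))].

Arguments almost_rep {F A} s eps d psi.

Definition almost_fd_reps (F : fieldType) (A : algType F) : Prop :=
  forall s : seq A, inspan s 1 -> forall eps : rat, 0 < eps ->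
    exists (d : nat) (psi : A -> 'M[F]_d), almost_rep s eps d psi.

Definition in_SR (F : fieldType) (A : algType F) (p : A) : Prop :=
  ~ almost_fd_reps A \/
  (almost_fd_reps A /\
   forall delta : rat, 0 < delta ->
     exists s : seq A, [/\ inspan s 1, inspan s p &
       exists eta : rat, 0 < eta /\
         forall eps : rat, 0 < eps -> eps < eta ->
           forall (d : nat) (psi : A -> 'M[F]_d), almost_rep s eps d psi ->
             ((\rank (psi p))%:R : rat) < delta * d%:R]).

(* Main.v *)
(* Both directions rest on replacing a sofic morphism by honest linear maps.
   Since [A] has countable dimension, coordinates turn a lift
   [A -> prod_k M_(n_k)] into linear unital maps [Phi_k]; for [omega]-almost
   every [k] the map [Phi_k] is an almost representation, and a nonzero [p] whose
   image has positive rank is then not in the radical.  Conversely, if the radical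
   vanishes, every [q <> 0] has almost representations [R q k] on growing subspaces
   with the normalized rank of [R q k q] bounded below.  The ultralimit of [R q] has
   a kernel avoiding [q], and countable dimension lets countably many [q_j] have
   kernels with trivial intersection; the direct sum of the [R q_j], with the [j]-th
   one of relative size about [2^-j], is an injective limit morphism. *)
Require Import Defs.
From HB Require Import structures.
From mathcomp Require Import all_boot all_order all_algebra.
From mathcomp Require Import zify ring lra.
From mathcomp Require Import boolp classical_sets filter.
Set Implicit Arguments. Unset Strict Implicit. Unset Printing Implicit Defensive.
Import Order.TTheory GRing.Theory Num.Theory.
Local Open Scope ring_scope.

(** * Ultrafilters and normalized rank *)

(** An ultrafilter refining the cofinite filter contains every tail, hence no singleton. *)
Lemma nonprincipal_ultrafilter_exists :
  exists U, ultrafilter U /\ nonprincipal U.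
Proof.
have [U [Uu Uoo]] := ultraFilterLemma eventually_filter.
have Up := @ultra_proper _ _ Uu.
exists U; split; last first.
  move=> m Um.
  have /Uoo Ugt : eventually (fun k => (m < k)%N) by exists m.+1.
  apply: (@filter_not_empty _ U).
  by apply: filterS (filterI Um Ugt) => k [/= ->]; rewrite ltnn.
split.
- exact: filterT.
- exact: filter_not_empty.
- by move=> S T US ST; apply: filterS US.
- by move=> S T; apply: filterI.
- move=> S; exact: (in_ultra_setVsetC S Uu).
Qed.

Lemma ultrafilter_tail U (K : nat) : ultrafilter U -> nonprincipal U ->
  U (fun k => (K <= k)%N).
Proof.
case=> UT UF US UI UC Un; elim: K => [|K IH].
  by apply: (US _ _ UT) => k.
case: (UC (fun k => k = K)) => [/Un //|UK].
apply: (US _ _ (UI _ _ IH UK)) => k [Kk kK].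
by rewrite ltn_neqAle Kk eq_sym andbT; apply/eqP.
Qed.

Definition nrank (F : fieldType) n (M : 'M[F]_n) : rat := (\rank M)%:R / n%:R.

Lemma nrank_ge0 (F : fieldType) n (M : 'M[F]_n) : 0 <= nrank M.
Proof. by rewrite divr_ge0 ?ler0n. Qed.

Lemma ler_nrank (F : fieldType) n (M N : 'M[F]_n) :
  (\rank M <= \rank N)%N -> nrank M <= nrank N.
Proof. by move=> le_MN; rewrite ler_wpM2r ?invr_ge0 ?ler0n ?ler_nat. Qed.

Lemma nrankD (F : fieldType) n (M N : 'M[F]_n) :
  nrank (M + N) <= nrank M + nrank N.
Proof.
by rewrite -mulrDl -natrD ler_wpM2r ?invr_ge0 ?ler0n // ler_nat mxrank_add.
Qed.

Lemma nrank0 (F : fieldType) n : nrank (0 : 'M[F]_n) = 0.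
Proof. by rewrite /nrank mxrank0 mul0r. Qed.

(** The sizes [n k] and [m k] may differ, so that a summand can be compared with a direct sum
    containing it. *)
Lemma rho_null_bound (F : fieldType) U n m (a : forall k, 'M[F]_(n k))
    (b : forall k, 'M[F]_(m k)) (C : rat) (S : nat -> Prop) :
  ultrafilter U -> U S -> (forall k, S k -> nrank (a k) <= C * nrank (b k)) ->
  rho_null U b -> rho_null U a.
Proof.
case=> UT UF Usub UI UC US le_ab null_b eps eps0.
have C0 : 0 < `|C| + 1 by rewrite ltr_wpDl.
apply: Usub (UI _ _ US (null_b (eps / (`|C| + 1)) _)) _; first by rewrite divr_gt0.
move=> k [Sk]; rewrite ltr_pdivlMr // => ltb.
apply: le_lt_trans (le_ab k Sk) (le_lt_trans _ ltb).
rewrite mulrC ler_wpM2l ?nrank_ge0 //.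
by apply: le_trans (ler_norm C) _; rewrite lerDl.
Qed.

Lemma rho_null_le (F : fieldType) U n (a b : forall k, 'M[F]_(n k)) :
  ultrafilter U -> (forall k, \rank (a k) <= \rank (b k))%N ->
  rho_null U b -> rho_null U a.
Proof.
move=> Uu le_ab null_b; case: (Uu) => UT *.
apply: (rho_null_bound (C := 1) Uu UT _ null_b) => k _.
by rewrite mul1r ler_nrank.
Qed.

Lemma rho_null0 (F : fieldType) U n (a : forall k, 'M[F]_(n k)) (S : nat -> Prop) :
  ultrafilter U -> U S -> (forall k, S k -> a k = 0) -> rho_null U a.
Proof.
case=> UT UF Usub UI UC US a0 eps eps0; apply: (Usub _ _ US) => k /a0 ->.
by rewrite mxrank0 mul0r.
Qed.

Lemma rho_nullD (F : fieldType) U n (a b : forall k, 'M[F]_(n k)) :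
  ultrafilter U -> rho_null U a -> rho_null U b ->
  rho_null U (fun k => a k + b k).
Proof.
case=> UT UF Usub UI UC null_a null_b eps eps0.
have e2 : 0 < eps / 2%:R by rewrite divr_gt0.
apply: (Usub _ _ (UI _ _ (null_a _ e2) (null_b _ e2))) => k [lta ltb].
apply: le_lt_trans (nrankD _ _) _; rewrite /nrank; lra.
Qed.

Lemma rho_nullZ (F : fieldType) U n (a : forall k, 'M[F]_(n k)) (c : F) :
  ultrafilter U -> rho_null U a -> rho_null U (fun k => c *: a k).
Proof. by move=> Uu; apply: rho_null_le Uu _ => k; apply: mxrank_scale. Qed.

Lemma rho_nullN (F : fieldType) U n (a : forall k, 'M[F]_(n k)) :
  ultrafilter U -> rho_null U a -> rho_null U (fun k => - a k).
Proof. by move=> Uu; apply: rho_null_le Uu _ => k; rewrite -scaleN1r mxrank_scale. Qed.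

Lemma rho_null_eq (F : fieldType) U n (a b : forall k, 'M[F]_(n k)) :
  (forall k, a k = b k) -> rho_null U a -> rho_null U b.
Proof. by move=> ab; have -> : a = b by apply: functional_extensionality_dep. Qed.

(** * Finitely supported coordinates *)

(** A polynomial serves as a finitely supported sequence of coefficients, its [size] bounding the
    support. *)
Definition lincomb (F : fieldType) (V : lmodType F) (u : nat -> V) (p : {poly F}) : V :=
  \sum_(0 <= i < size p) p`_i *: u i.

Lemma lincomb_widen (F : fieldType) (V : lmodType F) (u : nat -> V) (p : {poly F}) N :
  (size p <= N)%N -> lincomb u p = \sum_(0 <= i < N) p`_i *: u i.
Proof.
move=> szp; rewrite /lincomb (big_cat_nat (n := size p) _ szp) //=.
rewrite [X in _ + X]big_nat_cond [X in _ + X]big1 ?addr0 // => i /andP[/andP[lei _] _].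
by rewrite nth_default // scale0r.
Qed.

Lemma lincomb_linear (F : fieldType) (V : lmodType F) (u : nat -> V) c p q :
  lincomb u (c *: p + q) = c *: lincomb u p + lincomb u q.
Proof.
pose N := maxn (size (c *: p + q)%R) (maxn (size p) (size q)).
rewrite !(@lincomb_widen _ _ u _ N) ?leq_max ?leqnn ?orbT //.
rewrite scaler_sumr -big_split; apply: eq_bigr => i _ /=.
by rewrite coefD coefZ scalerDl scalerA.
Qed.

Lemma lincomb_poly (F : fieldType) (V : lmodType F) (u : nat -> V) n (c : nat -> F) :
  lincomb u (\poly_(i < n) c i) = \sum_(0 <= i < n) c i *: u i.
Proof.
rewrite (lincomb_widen _ (size_poly _ _)) !big_mkord.
by apply: eq_bigr => i _; rewrite coef_poly ltn_ord.
Qed.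

Lemma lincomb0 (F : fieldType) (V : lmodType F) (u : nat -> V) : lincomb u 0 = 0.
Proof. by rewrite /lincomb size_poly0 big_geq. Qed.

Lemma lincomb_head (F : fieldType) (V : lmodType F) (u : nat -> V) : lincomb u 1%:P = u 0%N.
Proof.
by rewrite (@lincomb_widen _ _ _ _ 1) ?size_polyC ?leq_b1 // big_nat1 coefC scale1r.
Qed.

Definition prefix_span (F : fieldType) (A : lmodType F) (e : nat -> A) n : seq A :=
  [seq e i | i <- iota 0 n].

Lemma inspan_prefixP (F : fieldType) (A : lmodType F) (e : nat -> A) n x :
  inspan (prefix_span e n) x <-> exists2 p : {poly F}, (size p <= n)%N & x = lincomb e p.
Proof.
have szs : size (prefix_span e n) = n by rewrite size_map size_iota.
have nths i : (i < n)%N -> (prefix_span e n)`_i = e i.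
  by move=> lti; rewrite (nth_map 0%N) ?size_iota // nth_iota.
rewrite /inspan szs; split=> [[c ->]|[p szp ->]].
  exists (\poly_(i < n) (if insub i is Some j then c j else 0)); first exact: size_poly.
  by rewrite lincomb_poly big_mkord; apply: eq_bigr => i _; rewrite valK nths.
exists (fun i => p`_i); rewrite (lincomb_widen _ szp) big_mkord.
by apply: eq_bigr => i _; rewrite nths.
Qed.

Lemma inspan_prefix_le (F : fieldType) (A : lmodType F) (e : nat -> A) m n x :
  (m <= n)%N -> inspan (prefix_span e m) x -> inspan (prefix_span e n) x.
Proof.
move=> lemn /inspan_prefixP[p szp ->]; apply/inspan_prefixP.
by exists p => //; apply: leq_trans lemn.
Qed.

Lemma inspan_prefix_linear (F : fieldType) (A : lmodType F) (e : nat -> A) n c x y :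
  inspan (prefix_span e n) x -> inspan (prefix_span e n) y ->
  inspan (prefix_span e n) (c *: x + y).
Proof.
move=> /inspan_prefixP[p szp ->] /inspan_prefixP[q szq ->].
apply/inspan_prefixP; exists (c *: p + q); last by rewrite lincomb_linear.
rewrite (leq_trans (size_polyD _ _)) // geq_max szq andbT.
exact: leq_trans (size_scale_leq _ _) szp.
Qed.

(** With the unit in front, every nonempty prefix spans [1], and coordinates can send [1] to [1%:P];
    this makes the lifted maps exactly unital. *)
Lemma countable_dim_unital (F : fieldType) (A : algType F) : countable_dim A ->
  exists2 e : nat -> A, e 0%N = 1 & forall x, exists n, inspan (prefix_span e n) x.
Proof.
case=> e he; exists (fun i => if i is j.+1 then e j else 1) => // x.
have [n /inspan_prefixP[p szp ->]] := he x.
(* Multiplication by ['X] shifts the coefficients and leaves index 0 to the unit. *)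
exists n.+1; apply/inspan_prefixP; exists (p * 'X).
  by rewrite (leq_trans (size_polyMleq _ _)) // size_polyX addn2.
rewrite (lincomb_widen _ szp) (@lincomb_widen _ _ _ _ n.+1); last first.
  by rewrite (leq_trans (size_polyMleq _ _)) // size_polyX addn2.
rewrite big_nat_recl // coefMX scale0r add0r; apply: eq_bigr => i _.
by rewrite coefMX.
Qed.

(* The coordinates vanish at every index [i] with [e i] in the span of the
   previous vectors, which makes them unique and hence linear in [x]. *)
Lemma linear_coordinates (F : fieldType) (A : lmodType F) (e : nat -> A) :
  e 0%N != 0 -> (forall x, exists n, inspan (prefix_span e n) x) ->
  exists coord : A -> {poly F},
    [/\ forall c x y, coord (c *: x + y) = c *: coord x + coord y,
        coord (e 0%N) = 1%:P & forall x, lincomb e (coord x) = x].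
Proof.
move=> e0 he.
pose reduced (p : {poly F}) :=
  forall i, inspan (prefix_span e i) (e i) -> p`_i = 0.
have reducedP c p q : reduced p -> reduced q -> reduced (c *: p + q).
  by move=> rp rq i ei; rewrite coefD coefZ rp // rq // mulr0 addr0.
(* The leading term of a nonzero relation puts [e n] in the span of its predecessors; reducedness
   then kills the leading coefficient. *)
have ker p : reduced p -> lincomb e p = 0 -> p = 0.
  move=> rp; case szp: (size p) => [|n] ep.
    by apply/eqP; rewrite -size_poly_eq0 szp.
  have lp : p`_n != 0.
    have: lead_coef p != 0 by rewrite lead_coef_eq0 -size_poly_eq0 szp.
    by rewrite lead_coefE szp.
  case: (negP lp); apply/eqP/rp/inspan_prefixP.
  exists (\poly_(i < n) (- (p`_n)^-1 * p`_i)); first exact: size_poly.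
  rewrite lincomb_poly; move: ep; rewrite /lincomb szp big_nat_recr //= => /eqP; rewrite addrC addr_eq0.
  move=> /eqP /(congr1 (fun v => (p`_n)^-1 *: v)).
  rewrite scalerA mulVf // scale1r => ->; rewrite -scaleN1r scalerA scaler_sumr.
  by apply: eq_bigr => i _; rewrite scalerA mulrN1.
have inj p q : reduced p -> reduced q -> lincomb e p = lincomb e q -> p = q.
  move=> rp rq epq; apply/eqP; rewrite -subr_eq0 -(addrC (- q)) -scaleN1r; apply/eqP.
  by apply: ker; [exact: reducedP | rewrite lincomb_linear epq scaleN1r addNr].
have red n : forall x, inspan (prefix_span e n) x ->
    exists2 p, reduced p & lincomb e p = x.
  elim: n => [|n IH] x /inspan_prefixP[p szp ->].
    move: szp; rewrite leqn0 size_poly_eq0 => /eqP ->.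
    by exists 0 => // i _; rewrite coef0.
  have [|r rr eq_r] := IH (\sum_(0 <= i < n) p`_i *: e i).
    apply/inspan_prefixP; exists (\poly_(i < n) p`_i); first exact: size_poly.
    by rewrite lincomb_poly.
  (* A dependent [e n] is replaced by a reduced expression in its predecessors; an independent one
     is kept as ['X^n]. *)
  have [en|en] := pselect (inspan (prefix_span e n) (e n)).
    have [q rq eq_q] := IH _ en.
    exists (p`_n *: q + r); first exact: reducedP.
    by rewrite lincomb_linear eq_q eq_r (lincomb_widen _ szp) big_nat_recr //= addrC.
  exists (p`_n *: 'X^n + r).
    apply: reducedP => // i; rewrite coefXn; have [->|//] := eqVneq i n.
    by move=> /en.
  rewrite lincomb_linear eq_r (lincomb_widen _ szp) big_nat_recr //= addrC. congr (_ *: _ + _).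
  rewrite /lincomb size_polyXn big_nat_recr //= coefXn eqxx scale1r big_nat.
  rewrite big1 ?add0r // => i /andP[_ lti].
  by rewrite coefXn ltn_eqF // scale0r.
have [coord coordP] : exists coord, forall x, reduced (coord x) /\ lincomb e (coord x) = x.
  have /choice[f fP] : forall x, exists p, reduced p /\ lincomb e p = x.
    by move=> x; have [n /red[p rp ep]] := he x; exists p.
  by exists f.
have coord_red x := (coordP x).1; have coordK x := (coordP x).2.
exists coord; split=> // [c x y|].
  by apply: inj => //; [exact: reducedP | rewrite lincomb_linear !coordK].
apply: inj => //; last by rewrite coordK lincomb_head.
(* At index 0 the prefix is empty, so the condition would force [e 0] to vanish. *)
move=> [|i] ei; last by rewrite coefC.
case/eqP: e0; case/inspan_prefixP: ei => p; rewrite leqn0 size_poly_eq0 => /eqP -> ->.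
exact: lincomb0.
Qed.

(** * From linear sofic algebras to almost representations *)

(** Codimensions of kernels add up at most under intersection; each new kernel is allotted half of
    the current [eps]. *)
Lemma rho_null_common_kernel (F : fieldType) (T : eqType) U n
    (D : T -> forall k, 'M[F]_(n k)) (l : seq T) (eps : rat) :
  ultrafilter U -> (forall t, rho_null U (D t)) -> 0 < eps ->
  U (fun k => exists2 W : 'M[F]_(n k),
       ((n k - \rank W)%:R / (n k)%:R : rat) < eps &
       forall t, t \in l -> W *m D t k = 0).
Proof.
move=> [UT UF Usub UI UC] null_D.
elim: l eps => [|t l IH] eps eps0.
  apply: (Usub _ _ UT) => k _; exists 1%:M => //.
  by rewrite mxrank1 subnn mul0r.
have e2 : 0 < eps / 2%:R by rewrite divr_gt0.
apply: (Usub _ _ (UI _ _ (IH _ e2) (null_D t _ e2))) => k [[W ltW WD] ltD].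
exists (kermx (D t k) :&: W)%MS; last first.
  move=> t'; rewrite inE => /predU1P[->|/WD WD'].
    by apply/eqP; rewrite -sub_kermx capmxSl.
  by have /submxP[V ->] := capmxSr (kermx (D t k)) W; rewrite -mulmxA WD' mulmx0.
apply: (@le_lt_trans _ _ ((n k - \rank W)%:R / (n k)%:R + nrank (D t k))); last first.
  by rewrite /nrank; lra.
rewrite -mulrDl -natrD ler_wpM2r ?invr_ge0 ?ler0n // ler_nat.
have := mxrank_sum_cap (kermx (D t k)) W; rewrite mxrank_ker.
have := rank_leq_col (kermx (D t k) + W)%MS; have := rank_leq_col W.
have := rank_leq_col (D t k); lia.
Qed.

(** The lift [phi] is linear only modulo null sequences. Keeping its values on the [e i] and
    extending along linear coordinates gives exact linearity; each [x] involves finitely many [e i],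
    so the change is null. *)
Lemma linear_sofic_linear_lift (F : fieldType) (A : algType F) :
  countable_dim A -> linear_sofic A ->
  exists (U : (nat -> Prop) -> Prop) (n : nat -> nat)
         (Phi : A -> forall k, 'M[F]_(n k)),
  [/\ ultrafilter U, nonprincipal U & tends_to_infty n] /\
  [/\ forall c x y k, Phi (c *: x + y) k = c *: Phi x k + Phi y k,
      forall k, Phi 1 k = 1%:M,
      forall x y, rho_null U (fun k => Phi (x * y) k - Phi x k *m Phi y k) &
      forall x, rho_null U (Phi x) -> x = 0].
Proof.
case/countable_dim_unital => e e0 he [U [n [phi [[Uu Un n_oo] [phiD phiZ phiM phi1 phi_inj]]]]].
have [|coord [coordP coord1 coordK]] := @linear_coordinates _ _ e _ he.
  by rewrite e0 oner_neq0.
(* At index 0, where [e 0 = 1], the value is corrected to the identity. *)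
pose b i k : 'M[F]_(n k) := if i is 0%N then 1%:M else phi (e i) k.
pose Phi x k := lincomb (b^~ k) (coord x).
have bP i : rho_null U (fun k => phi (e i) k - b i k).
  case: i => [|i]; first by rewrite e0.
  by case: (Uu) => UT *; apply: (rho_null0 Uu UT) => k _; rewrite subrr.
have PhiE x : rho_null U (fun k => phi x k - Phi x k).
  rewrite -[in phi x](coordK x) /Phi /lincomb; elim: (size _) => [|N IH].
    (* For the empty sum, [phi 0] is null by homogeneity with scalar 0. *)
    apply: (rho_null_eq (a := fun k => phi (0 *: 0) k - 0 *: phi 0 k)) (phiZ 0 0) => k.
    by rewrite !big_geq // scaler0 scale0r.
  set c := (coord x)`_N.
  pose X := \sum_(0 <= i < N) (coord x)`_i *: e i.
  have := rho_nullD Uu (rho_nullD Uu (phiD X (c *: e N)) (phiZ c (e N)))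
            (rho_nullD Uu IH (rho_nullZ c Uu (bP N))).
  apply: rho_null_eq => k; rewrite !big_nat_recr //= -/c -/X scalerBr.
  by rewrite [X in X + _ = _]addrA subrK addrACA addKr addrA subrK opprD addrA.
exists U, n, Phi; split=> //; split.
- by move=> c x y k; rewrite /Phi coordP lincomb_linear.
- by move=> k; rewrite /Phi -e0 coord1 lincomb_head.
- move=> x y.
  have nl : rho_null U (fun k => (phi x k - Phi x k) *m phi y k).
    by apply: rho_null_le Uu _ (PhiE x) => k; rewrite mxrankM_maxl.
  have nr : rho_null U (fun k => Phi x k *m (phi y k - Phi y k)).
    by apply: rho_null_le Uu _ (PhiE y) => k; rewrite mxrankM_maxr.
  (* The defect of [Phi] telescopes through [phi (x * y)], [phi x *m phi y] and [Phi x *m phi y]. *)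
  have := rho_nullD Uu (rho_nullD Uu (rho_nullN Uu (PhiE (x * y))) (phiM x y))
            (rho_nullD Uu nl nr).
  apply: rho_null_eq => k; rewrite mulmxBl mulmxBr opprB.
  by rewrite !addrA !subrK.
- move=> x null_x; apply: phi_inj; have := rho_nullD Uu (PhiE x) null_x.
  by apply: rho_null_eq => k; rewrite subrK.
Qed.

(** Applied in each variable in turn, this reduces multiplicativity on a span to finitely many pairs
    of generators. *)
Lemma linear_inspan_eq0 (F : fieldType) (A V : lmodType F) (f : A -> V) s x :
  (forall c x y, f (c *: x + y) = c *: f x + f y) ->
  (forall y, y \in s -> f y = 0) -> inspan s x -> f x = 0.
Proof.
move=> fP fs [c ->]; have f0 : f 0 = 0.
  by have := fP (-1) 0 0; rewrite scaler0 addr0 scaleN1r addNr.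
elim/big_ind: _ => // [y z fy fz|i _]; first by rewrite -(scale1r y) fP fy fz scaler0 addr0.
by rewrite -[_ *: _]addr0 fP fs ?mem_nth // scaler0 f0 addr0.
Qed.

(* The elements of an almost representation act on row vectors, on the right,
   while the sofic morphism is multiplicative: hence the transposition. *)
Lemma linear_lift_almost_rep (F : fieldType) (A : algType F) U n
    (Phi : A -> forall k, 'M[F]_(n k)) (s : seq A) (eps : rat) :
  ultrafilter U -> nonprincipal U -> tends_to_infty n ->
  (forall c x y k, Phi (c *: x + y) k = c *: Phi x k + Phi y k) ->
  (forall k, Phi 1 k = 1%:M) ->
  (forall x y, rho_null U (fun k => Phi (x * y) k - Phi x k *m Phi y k)) ->
  0 < eps ->
  U (fun k => almost_rep s eps (n k) (fun x => (Phi x k)^T)).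
Proof.
move=> Uu Un n_oo PhiP Phi1 PhiM eps0.
pose D (t : A * A) k := (Phi (t.1 * t.2) k - Phi t.1 k *m Phi t.2 k)^T.
have null_D t : rho_null U (D t).
  by apply: rho_null_le Uu _ (PhiM t.1 t.2) => k; rewrite mxrank_tr.
(* A positive size allows the denominator in the codimension bound to be cleared. *)
have [K Kn] := n_oo 1%N.
have := rho_null_common_kernel [seq (x, y) | x <- s, y <- s] Uu null_D eps0.
case: (Uu) => _ _ Usub UI _ Uker.
apply: Usub (UI _ _ Uker (ultrafilter_tail K Uu Un)) _ => k [[W ltW WD] /Kn nk0].
have PhiTP c x y : (Phi (c *: x + y) k)^T = c *: (Phi x k)^T + (Phi y k)^T.
  by rewrite PhiP linearD linearZ.
split=> //; first by rewrite Phi1 trmx1.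
exists W; split; first by rewrite -ltr_pdivrMr // ltr0n.
move=> a b sa sb _ v /submxP[u ->]; rewrite -!mulmxA; congr (u *m _).
(* The multiplicativity defect on [W] is bilinear and vanishes on pairs of generators. *)
pose g x y := W *m ((Phi y k)^T *m (Phi x k)^T) - W *m (Phi (x * y) k)^T.
suff : g a b = 0 by move/eqP; rewrite subr_eq0 => /eqP.
have gx y c x x' : g (c *: x + x') y = c *: g x y + g x' y.
  rewrite /g mulrDl -scalerAl !PhiTP !mulmxDr -!scalemxAr scalerBr.
  by rewrite opprD addrACA.
have gy x c y y' : g x (c *: y + y') = c *: g x y + g x y'.
  rewrite /g mulrDr -scalerAr !PhiTP mulmxDl !mulmxDr -scalemxAl -!scalemxAr scalerBr.
  by rewrite opprD addrACA.
apply: (linear_inspan_eq0 (gx b)) sa => x sx.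
apply: (linear_inspan_eq0 (gy x)) sb => y sy.
have := WD (x, y) (allpairs_f _ sx sy).
by rewrite /D /= linearB /= mulmxBr trmx_mul => /(congr1 -%R); rewrite opprB oppr0.
Qed.

(** The codimension bound is strict, which excludes dimension 0, where its right-hand side
    vanishes. *)
Lemma almost_rep_dim_gt0 (F : fieldType) (A : algType F) (s : seq A) eps d
  (psi : A -> 'M[F]_d) : almost_rep s eps d psi -> (0 < d)%N.
Proof.
case=> _ _ [W [ltW _]]; rewrite lt0n; apply: contraTneq ltW => d0.
by rewrite -leNgt [X in _ * X%:R]d0 mulr0 ler0n.
Qed.

Lemma linear_sofic_SR_eq0 (F : fieldType) (A : algType F) :
  countable_dim A -> linear_sofic A -> forall p : A, in_SR p <-> p = 0.
Proof.
move=> hA /(linear_sofic_linear_lift hA)[U [n [Phi [[Uu Un n_oo] [PhiP Phi1 PhiM Phi_inj]]]]].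
have rep s eps := @linear_lift_almost_rep _ _ _ _ _ s eps Uu Un n_oo PhiP Phi1 PhiM.
case: (Uu) => UT UF Usub UI UC.
have U_ex S : U S -> exists k, S k.
  by move=> US; apply: contrapT => nS; apply/UF/(Usub _ _ US) => k Sk; apply: nS; exists k.
have fd : almost_fd_reps A.
  by move=> s s1 eps /(rep s) /U_ex[k repk]; exists (n k); eexists; apply: repk.
move=> p; split=> [[//|[_ SRp]]|->].
  apply: Phi_inj => delta delta0.
  have [s [_ _ [eta [eta0 small]]]] := SRp _ delta0.
  have e0 : 0 < eta / 2%:R by rewrite divr_gt0.
  apply: (Usub _ _ (rep s _ e0)) => k repk.
  rewrite ltr_pdivrMr ?ltr0n ?(almost_rep_dim_gt0 repk) //.
  by rewrite -mxrank_tr; apply: small repk; lra.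
(* For [p = 0] the span of [1] suffices: the rank is 0 and the dimension is positive. *)
right; split=> // delta delta0; exists [:: 1]; split.
- by exists (fun=> 1); rewrite big_ord1 scale1r.
- by exists (fun=> 0); rewrite big_ord1 scale0r.
exists 1; split=> // eps _ _ d psi repd.
have psi0 : psi 0 = 0.
  case: (repd) => psiP _ _; have s0 : inspan [:: 1] (0 : A).
    by exists (fun=> 0); rewrite big_ord1 scale0r.
  by have := psiP (-1) 0 0 s0 s0; rewrite scaler0 addr0 scaleN1r addNr.
by rewrite psi0 mxrank0 mulr_gt0 // ltr0n (almost_rep_dim_gt0 repd).
Qed.

(** * Weighted sums of almost representations *)

Lemma almost_rep_weaken (F : fieldType) (A : algType F) (s : seq A) eps eps' d
  (psi : A -> 'M[F]_d) : eps <= eps' -> almost_rep s eps d psi -> almost_rep s eps' d psi.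
Proof.
move=> le_eps [psiP psi1 [W [ltW WP]]]; split=> //; exists W; split=> //.
by apply: lt_le_trans ltW _; rewrite ler_wpM2r ?ler0n.
Qed.

Lemma almost_rep_dsum (F : fieldType) (A : algType F) (s : seq A) eps d1 d2
    (psi1 : A -> 'M[F]_d1) (psi2 : A -> 'M[F]_d2) :
  almost_rep s eps d1 psi1 -> almost_rep s eps d2 psi2 ->
  almost_rep s eps (d1 + d2) (fun x => block_mx (psi1 x) 0 0 (psi2 x)).
Proof.
move=> [psiP1 psi11 [W1 [ltW1 WP1]]] [psiP2 psi21 [W2 [ltW2 WP2]]]; split.
- by move=> c x y sx sy; rewrite psiP1 // psiP2 // scale_block_mx add_block_mx !scaler0 !addr0.
- by rewrite psi11 psi21 -scalar_mx_block.
exists (block_mx W1 0 0 W2); split.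
  rewrite rank_diag_block_mx natrD mulrDr.
  apply: le_lt_trans (ltrD ltW1 ltW2); rewrite -natrD ler_nat; lia.
move=> a b sa sb sab v /submxP[u ->]; rewrite -[u]hsubmxK mul_row_block !mulmx0 addr0 add0r.
by rewrite !mul_row_block !mulmx0 !addr0 !add0r WP1 ?WP2 ?submxMl.
Qed.

Lemma almost_rep_copies (F : fieldType) (A : algType F) (s : seq A) eps d
    (psi : A -> 'M[F]_d) c : (0 < c)%N -> almost_rep s eps d psi ->
  exists2 psi' : A -> 'M[F]_(c * d), almost_rep s eps (c * d) psi' &
    forall x, \rank (psi' x) = (c * \rank (psi x))%N.
Proof.
case: c => // c _ rep; elim: c => [|c [psi' rep' rank']].
  by rewrite mul1n; exists psi => // x; rewrite mul1n.
exists (fun x => block_mx (psi x) 0 0 (psi' x)); first exact: (almost_rep_dsum rep rep').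
by move=> x; rewrite [LHS]rank_diag_block_mx rank' mulSn.
Qed.

(** Repeated copies enlarge the dimension and preserve normalized ranks; this lets the sizes in the
    final embedding tend to infinity. *)
Lemma almost_rep_large (F : fieldType) (A : algType F) (s : seq A) eps d
    (psi : A -> 'M[F]_d) N : almost_rep s eps d psi ->
  exists d' (psi' : A -> 'M[F]_d'), [/\ almost_rep s eps d' psi', (N <= d')%N &
    forall x, nrank (psi' x) = nrank (psi x)].
Proof.
move=> rep; have [psi' rep' rank'] := almost_rep_copies (ltn0Sn N) rep.
have d0 := almost_rep_dim_gt0 rep.
exists (N.+1 * d)%N, psi'; split=> // [|x]; first by nia.
by rewrite /nrank rank' !natrM -mulf_div divff ?mul1r // pnatr_eq0.
Qed.

(** Taking [d2] copies of the first and [d1] of the second gives both blocks dimension [d1 * d2], so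
    normalized ranks are averaged. *)
Lemma almost_rep_mean (F : fieldType) (A : algType F) (s : seq A) eps d1 d2
    (psi1 : A -> 'M[F]_d1) (psi2 : A -> 'M[F]_d2) :
  almost_rep s eps d1 psi1 -> almost_rep s eps d2 psi2 ->
  exists d (psi : A -> 'M[F]_d), almost_rep s eps d psi /\
    forall x, nrank (psi x) = (nrank (psi1 x) + nrank (psi2 x)) / 2.
Proof.
move=> rep1 rep2; have d10 := almost_rep_dim_gt0 rep1; have d20 := almost_rep_dim_gt0 rep2.
have [psi1' rep1' rank1] := almost_rep_copies d20 rep1.
have [psi2' rep2' rank2] := almost_rep_copies d10 rep2.
exists (d2 * d1 + d1 * d2)%N, (fun x => block_mx (psi1' x) 0 0 (psi2' x)).
split=> [|x]; first exact: almost_rep_dsum.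
rewrite /nrank rank_diag_block_mx rank1 rank2 !natrD !natrM.
have n1 : d1%:R != 0 :> rat by rewrite pnatr_eq0 -lt0n.
have n2 : d2%:R != 0 :> rat by rewrite pnatr_eq0 -lt0n.
field; rewrite n1 n2 -!natrM -natrD pnatr_eq0; nia.
Qed.

(** The dimension is packaged with the map so that one application of choice selects both. *)
Definition matmap (F : fieldType) (A : algType F) := {d : nat & A -> 'M[F]_d}.

Definition is_almost_rep (F : fieldType) (A : algType F) s eps (r : matmap A) :=
  almost_rep s eps (projT1 r) (projT2 r).

(* The [j]-th entry of the list enters with weight [2^-(j+1)]. *)
Lemma almost_rep_weighted_sum (F : fieldType) (A : algType F) (s : seq A) eps
    (r0 : matmap A) (I : Type) (R : I -> matmap A) (l : seq I) N :
  is_almost_rep s eps r0 -> (forall i, is_almost_rep s eps (R i)) ->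
  exists r : matmap A, [/\ is_almost_rep s eps r, (N <= projT1 r)%N &
    forall l1 i l2, l = l1 ++ i :: l2 -> forall x,
      nrank (projT2 (R i) x) <= 2 ^+ (size l1).+1 * nrank (projT2 r x)].
Proof.
move=> rep0 repR.
suff [[d psi] rep bound] : exists2 r : matmap A, is_almost_rep s eps r &
    forall l1 i l2, l = l1 ++ i :: l2 -> forall x,
      nrank (projT2 (R i) x) <= 2 ^+ (size l1).+1 * nrank (projT2 r x).
  have [d' [psi' [rep' leN rank']]] := almost_rep_large N rep.
  exists (existT _ d' psi'); split=> // l1 i l2 /bound + x => /(_ x) /=.
  by rewrite rank'.
elim: l => [|i l [[d psi] rep bound]]; first by exists r0 => // - [].
(* Averaging gives the head weight one half and halves every later weight. *)
have [d' [psi' [rep' rank']]] := almost_rep_mean (repR i) rep.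
exists (existT _ d' psi') => //= - [|j l1] i' l2 [<-] => [_|eq_l] x /=.
  by rewrite rank' expr1; have := nrank_ge0 (psi x); lra.
apply: le_trans (bound _ _ _ eq_l x) _; rewrite [leRHS]mulrC [in leRHS]exprSr rank' [leRHS]mulrA [leRHS]mulrAC.
rewrite divfK // mulrDl [leLHS]mulrC lerDr.
by rewrite mulr_ge0 ?nrank_ge0 ?exprn_ge0.
Qed.

(** * Constructing the embedding *)

Lemma notin_SR (F : fieldType) (A : algType F) (p : A) : ~ in_SR p ->
  almost_fd_reps A /\ exists delta : rat, 0 < delta /\
    forall s eps, 0 < eps -> inspan s 1 -> inspan s p ->
      exists r : matmap A, is_almost_rep s eps r /\ delta <= nrank (projT2 r p).
Proof.
move=> nSR; have fd : almost_fd_reps A by apply: contrapT => nfd; apply: nSR; left.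
split=> //; apply: contrapT => nd; apply: nSR; right; split=> // delta delta0.
apply: contrapT => ns; apply: nd; exists delta; split=> // s eps eps0 s1 sp.
(* With [eta] equal to [eps], a counterexample at a smaller tolerance weakens to one at [eps]. *)
apply: contrapT => nr; apply: ns; exists s; split=> //; exists eps; split=> // eps' _ lt_eps d psi rep.
rewrite ltNge; apply/negP => le_rank; apply: nr; exists (existT _ d psi); split.
  exact: almost_rep_weaken (ltW lt_eps) rep.
by rewrite /nrank ler_pdivlMr ?ltr0n ?(almost_rep_dim_gt0 rep).
Qed.

(* If two vectors of the span of [e_0, ..., e_n] are killed by the previous
   tests, then they are proportional: one further test suffices. *)
Lemma finite_separation (F : fieldType) (A : lmodType F) (e : nat -> A)
    (J : A -> A -> Prop) n :
  (forall q c x y, J q x -> J q y -> J q (c *: x + y)) ->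
  (forall q, q != 0 -> ~ J q q) ->
  exists P : seq A, forall x, inspan (prefix_span e n) x ->
    (forall q, q \in P -> q != 0 -> J q x) -> x = 0.
Proof.
move=> JP Jn; elim: n => [|n [P sepP]].
  exists [::] => x /inspan_prefixP[p]; rewrite leqn0 size_poly_eq0 => /eqP -> -> _.
  exact: lincomb0.
pose K x := inspan (prefix_span e n.+1) x /\ forall q, q \in P -> q != 0 -> J q x.
(* If the previous tests leave a nonzero common kernel, any nonzero [q] in it is the new test. *)
have [[q [Kq q0]]|K0] := pselect (exists q, K q /\ q != 0); last first.
  by exists P => x sx Px; apply: contrapT => /eqP x0; apply: K0; exists x.
exists (q :: P) => x sx Px.
have Kx : K x by split=> // q' Pq'; apply: Px; rewrite inE Pq' orbT.
have split_last y : inspan (prefix_span e n.+1) y ->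
    exists c, inspan (prefix_span e n) (y - c *: e n).
  case/inspan_prefixP=> p szp ->; exists p`_n; apply/inspan_prefixP.
  exists (\poly_(i < n) p`_i); first exact: size_poly.
  by rewrite (lincomb_widen _ szp) lincomb_poly big_nat_recr //= addrK.
have [a xa] := split_last _ Kx.1; have [b qb] := split_last _ Kq.1.
(* The difference has no [e n] component and passes the previous tests, so the induction hypothesis
   makes it vanish. *)
have bx : b *: x = a *: q.
  apply/eqP; rewrite -subr_eq0; apply/eqP/sepP => [|q' Pq' q'0].
    have z : inspan (prefix_span e n) (0 : A).
      by apply/inspan_prefixP; exists 0; rewrite ?size_poly0 ?lincomb0.
    have := inspan_prefix_linear b xa (inspan_prefix_linear (- a) qb z).
    rewrite addr0 !scalerBr !scaleNr !scalerA (mulrC b a) opprK.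
    by rewrite addrACA addNr addr0.
  have J0 : J q' 0.
    by have := JP q' (-1) _ _ (Kx.2 _ Pq' q'0) (Kx.2 _ Pq' q'0); rewrite scaleN1r addNr.
  rewrite addrC -scaleNr; apply: (JP); first exact: Kq.2.
  by rewrite -[_ *: x]addr0; apply: JP => //; apply: Kx.2.
have b0 : b != 0.
  apply: contra_neq q0 => b0; apply: sepP; last exact: Kq.2.
  by move: qb; rewrite b0 scale0r subr0.
have [a0|a0] := eqVneq a 0.
  by rewrite -[x](scalerK b0) bx a0 scale0r scaler0.
(* Now [q] is a multiple of [x], which satisfies [J q]; hence [J q q], a contradiction. *)
case: (Jn _ q0); rewrite -[X in J _ X](scalerK a0) -bx scalerA.
have Jx : J q x by apply: Px; rewrite // mem_head.
have J0 : J q 0 by have := JP q (-1) _ _ Jx Jx; rewrite scaleN1r addNr.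
by rewrite -[_ *: x]addr0; apply: JP.
Qed.

Lemma SR_eq0_linear_sofic (F : fieldType) (A : algType F) :
  countable_dim A -> (forall p : A, in_SR p <-> p = 0) -> linear_sofic A.
Proof.
move=> /countable_dim_unital[e e0 he] SR0.
have nSR (q : A) : q != 0 -> ~ in_SR q by move=> /eqP q0 /SR0/q0.
have [fd _] := notin_SR (nSR _ (oner_neq0 A)).
have [U [Uu Un]] := nonprincipal_ultrafilter_exists.
have tail K := ultrafilter_tail K Uu Un.
(* The shift by one puts [e 0 = 1] into every [s k]. *)
pose s k := prefix_span e k.+1.
pose eps k : rat := k.+1%:R^-1.
have eps0 k : 0 < eps k by rewrite invr_gt0 ltr0n.
have s1 k : inspan (s k) 1.
  by apply/inspan_prefixP; exists 1%:P; rewrite ?lincomb_head // size_polyC oner_neq0.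
have s_tail x : exists K, forall k, (K <= k)%N -> inspan (s k) x.
  have [n sx] := he x; exists n => k le_nk; apply: inspan_prefix_le sx; exact: leqW.
have [R [repR R_neq0]] : exists R : A -> nat -> matmap A,
    (forall q k, is_almost_rep (s k) (eps k) (R q k)) /\
    forall q, q != 0 -> exists2 delta : rat, 0 < delta &
      forall k, inspan (s k) q -> delta <= nrank (projT2 (R q k) q).
  have /choice[R RP] : forall q, exists Rq : nat -> matmap A,
      (forall k, is_almost_rep (s k) (eps k) (Rq k)) /\
      (q != 0 -> exists2 delta : rat, 0 < delta &
      forall k, inspan (s k) q -> delta <= nrank (projT2 (Rq k) q)).
    move=> q.
    have base k : exists r : matmap A, is_almost_rep (s k) (eps k) r.
      by have [d [psi rep]] := fd _ (s1 k) _ (eps0 k); exists (existT _ d psi).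
    have [q0|q0] := pselect (q != 0); last first.
      by have /choice[Rq RqP] := base; exists Rq.
    have [_ [delta [delta0 reps]]] := notin_SR (nSR _ q0).
    have /choice[Rq RqP] : forall k, exists r : matmap A, is_almost_rep (s k) (eps k) r /\
        (inspan (s k) q -> delta <= nrank (projT2 r q)).
      move=> k; have [sq|nsq] := pselect (inspan (s k) q).
        by have [r [? ?]] := reps _ _ (eps0 k) (s1 k) sq; exists r.
      by have [r rep] := base k; exists r.
    exists Rq; split=> [k|_]; first by case: (RqP k).
    by exists delta => // k; case: (RqP k).
  by exists R; split=> [q k|q]; case: (RP q).
(* This is the kernel of the ultralimit of the [R q k]; for [q != 0] the lower bound on ranks keeps
   [q] out of it. *)
pose J q x := rho_null U (fun k => projT2 (R q k) x).
have JP q c x y : J q x -> J q y -> J q (c *: x + y).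
  move=> Jx Jy.
  have [Kx sx] := s_tail x; have [Ky sy] := s_tail y.
  have := rho_nullD Uu (rho_nullZ c Uu Jx) Jy.
  apply: (rho_null_bound (C := 1) Uu (tail (maxn Kx Ky))) => k.
  rewrite geq_max => /andP[/sx sxk /sy syk]; rewrite mul1r.
  by case: (repR q k) => -> .
have Jn q : q != 0 -> ~ J q q.
  move=> q0 Jq; have [delta delta0 le_delta] := R_neq0 q q0.
  have [K sq] := s_tail q; case: (Uu) => _ UF Usub UI _.
  apply/UF/(Usub _ _ (UI _ _ (Jq _ delta0) (tail K))) => k [lt_delta /sq /le_delta].
  by rewrite leNgt lt_delta.
have /choice[P sepP] n := finite_separation e n JP Jn.
(* Tests are only appended as [k] grows, so a test keeps its position in [Q k], and with it its
   weight. *)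
pose Q k := flatten [seq P i | i <- iota 0 k].
have /choice[Psi PsiP] : forall k, exists r : matmap A,
    [/\ is_almost_rep (s k) (eps k) r, (k <= projT1 r)%N &
      forall l1 q l2, Q k = l1 ++ q :: l2 -> forall x,
      nrank (projT2 (R q k) x) <= 2 ^+ (size l1).+1 * nrank (projT2 r x)].
  move=> k; exact: (@almost_rep_weighted_sum _ _ _ _ _ _ (R^~ k) _ _ (repR 0 k) (repR^~ k)).
have repPsi k : is_almost_rep (s k) (eps k) (Psi k) by case: (PsiP k).
(* Almost representations act on row vectors, so transposition restores the order of products. *)
exists U, (fun k => projT1 (Psi k)), (fun x k => (projT2 (Psi k) x)^T); split.
  split=> // N; exists N => k le_Nk; apply: leq_trans le_Nk _; by case: (PsiP k).
have s0 k : inspan (s k) 0.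
  by have := inspan_prefix_linear (-1) (s1 k) (s1 k); rewrite scaleN1r addNr.
have PsiL k c x y : inspan (s k) x -> inspan (s k) y ->
    projT2 (Psi k) (c *: x + y) = c *: projT2 (Psi k) x + projT2 (Psi k) y.
  by case: (repPsi k) => + _ _; apply.
have Psi0 k : projT2 (Psi k) 0 = 0.
  by have := PsiL k (-1) 0 0 (s0 k) (s0 k); rewrite scaler0 addr0 scaleN1r addNr.
split.
- move=> x y; have [Kx sx] := s_tail x; have [Ky sy] := s_tail y.
  apply: (rho_null0 Uu (tail (maxn Kx Ky))) => k.
  rewrite geq_max => /andP[/sx sxk /sy syk].
  by rewrite -[x in x + y]scale1r PsiL // scale1r linearD /= addrAC addrK subrr.
- move=> c x; have [Kx sx] := s_tail x.
  apply: (rho_null0 Uu (tail Kx)) => k /sx sxk.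
  by rewrite -[c *: x]addr0 PsiL // Psi0 addr0 -linearZ -linearB /= subrr trmx0.
- move=> x y delta delta0.
  have [Kx sx] := s_tail x; have [Ky sy] := s_tail y; have [Kz sz] := s_tail (x * y).
  have [N ltN] : exists N, eps N < delta.
    exists (Num.bound delta^-1); rewrite /eps invf_plt ?posrE //.
    apply: lt_le_trans (archi_boundP _) _; first by rewrite invr_ge0 ltW.
    by rewrite ler_nat.
  case: (Uu) => _ _ Usub UI _.
  apply: Usub (tail (maxn N (maxn Kx (maxn Ky Kz)))) _ => k.
  rewrite !geq_max => /and4P[leN /sx sxk /sy syk /sz szk].
  have rep := repPsi k; rewrite ltr_pdivrMr ?ltr0n ?(almost_rep_dim_gt0 rep) //.
  case: rep => _ _ [W [ltW WP]].
  rewrite -trmx_mul -linearB mxrank_tr /=.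
  set D := (X in \rank X).
  (* Since [W] kills the defect [D], the rank of [D] is at most the codimension of [W]. *)
  have WD : W *m D = 0.
    apply/row_matrixP => i; rewrite row_mul row0 /D mulmxBr mulmxA.
    by rewrite (WP _ _ sxk syk szk) ?row_sub // subrr.
  have := mulmx0_rank_max WD => le_rank.
  apply: (@le_lt_trans _ _ (projT1 (Psi k) - \rank W)%:R); first by rewrite ler_nat; lia.
  apply: lt_le_trans ltW _; rewrite ler_wpM2r ?ler0n //; apply: le_trans (ltW ltN).
  by rewrite lef_pV2 ?posrE ?ltr0n // ler_nat.
- have [UT _ _ _ _] := Uu; apply: (rho_null0 Uu UT) => k _.
  by case: (repPsi k) => _ -> _; rewrite trmx1 subrr.
move=> x null_x; have [n sx] := he x; apply: (sepP n) => // q Pq _.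
have null_Psi : rho_null U (fun k => projT2 (Psi k) x).
  by apply: rho_null_le Uu _ null_x => k; rewrite mxrank_tr.
have [a [b eq_P]] : exists a b, P n = a ++ q :: b by case/splitPr: Pq => a b; exists a, b.
(* For every [k > n] the test [q] sits in [Q k] right after [Q n ++ a], so the constant does not
   depend on [k]. *)
apply: (rho_null_bound (C := 2 ^+ (size (Q n ++ a)).+1) Uu (tail n.+1) _ null_Psi) => k lt_nk.
case: (PsiP k) => _ _ /(_ (Q n ++ a) q (b ++ flatten [seq P i | i <- iota n.+1 (k - n.+1)])).
apply; rewrite /Q -(subnKC lt_nk) iotaD add0n map_cat flatten_cat -{1}[n.+1]addn1 iotaD.
by rewrite map_cat flatten_cat /= cats0 eq_P -!catA subnKC.
Qed.

Theorem mainTheorem18 (F : fieldType) (A : algType F) (hA : countable_dim A) :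
  linear_sofic A <-> (forall p : A, in_SR p <-> p = 0).
Proof.
by split; [exact: linear_sofic_SR_eq0 | exact: SR_eq0_linear_sofic].
Qed.
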